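(* Let $X$ be a complex Banach space and let $T$ be a bounded linear operator on $X$. If $T$ is pseudo B-Fredholm, then $T$ is pseudo Fredholm.
   Context: For a bounded operator $T$ on $X$, write $N(T)$ and $R(T)$ for its kernel and range, and $R^{\infty}(T)=\bigcap_{n\ge 0}R(T^n)$. $T$ is Fredholm if $\dim N(T)<\infty$ and $\operatorname{codim} R(T)<\infty$. $T$ is a Kato (or semi-regular) operator if $R(T)$ is closed and $N(T)\subseteq R^{\infty}(T)$. $T$ is quasi-nilpotent if $\sigma(T)\subseteq\{0\}$. A decomposition $X=X_1\oplus X_2$, $T=T_1\oplus T_2$ means that $X_1,X_2$ are closed $T$-invariant subspaces of $X$ (possibly $\{0\}$) with $X$ their direct sum, and $T_i=T|_{X_i}$. $T$ is pseudo B-Fredholm if there is such a decomposition with $T_1$ Fredholm and $T_2$ quasi-nilpotent. $T$ is pseudo Fredholm (admits a generalized Kato decomposition) if there is such a decomposition with $T_1$ a Kato operator and $T_2$ quasi-nilpotent. *)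

(* Defs.v *)
From mathcomp Require Import all_boot all_order all_algebra.
From mathcomp Require Import all_classical all_reals all_analysis.
From mathcomp Require Export complex.
Import GRing.Theory Num.Theory numFieldNormedType.Exports.

Set Implicit Arguments.
Unset Strict Implicit.
Unset Printing Implicit Defensive.

Local Open Scope classical_set_scope.
Local Open Scope complex_scope.
Local Open Scope ring_scope.

(* Subspaces are sets [M : set X], and the restriction of an operator to a
   [T]-invariant closed [M] is represented by the pair [M], [T]: each notion
   below is that of the operator [T|M] on the space [M], and for [M = setT]
   that of [T] itself. *)

Definition closed_subspace (R : realType) (X : normedModType R[i])
    (M : set X) : Prop :=
  closed M /\ GRing.submod_closed (mem M).

Definition invariant (R : realType) (X : normedModType R[i])
    (T : X -> X) (M : set X) : Prop :=
  forall x, M x -> M (T x).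

Definition bounded_operator (R : realType) (X : normedModType R[i])
    (M : set X) (T : X -> X) : Prop :=
  exists C : R, forall x, M x -> `|T x| <= C%:C * `|x|.

Definition kernel (R : realType) (X : normedModType R[i])
    (M : set X) (T : X -> X) : set X :=
  [set x | M x /\ T x = 0].

Definition hyper_range (R : realType) (X : normedModType R[i])
    (M : set X) (T : X -> X) : set X :=
  \bigcap_n (iter n T @` M).

(* For a subspace [N] of [M], the quotient [M / N] is spanned by finitely many
   classes; the vectors [e i] may be dependent or repeated. *)
Definition finite_codim (R : realType) (X : normedModType R[i])
    (M N : set X) : Prop :=
  exists (n : nat) (e : 'I_n -> X), (forall i, M (e i)) /\
    forall x, M x -> exists c : 'I_n -> R[i], N (x - \sum_(i < n) c i *: e i).

Definition finite_dim (R : realType) (X : normedModType R[i])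
    (M : set X) : Prop :=
  finite_codim M [set 0].

Definition fredholm (R : realType) (X : normedModType R[i])
    (M : set X) (T : X -> X) : Prop :=
  finite_dim (kernel M T) /\ finite_codim M (T @` M).

(* [M] is closed in all uses, so being closed in [M] is being closed in [X]. *)
Definition kato (R : realType) (X : normedModType R[i])
    (M : set X) (T : X -> X) : Prop :=
  closed (T @` M) /\ kernel M T `<=` hyper_range M T.

(* The linearity of [S] on [M] follows from that of [T]. *)
Definition invertible (R : realType) (X : normedModType R[i])
    (M : set X) (T : X -> X) : Prop :=
  exists S : X -> X, [/\ invariant S M, bounded_operator M S &
    forall x, M x -> S (T x) = x /\ T (S x) = x].

Definition spectrum (R : realType) (X : normedModType R[i])
    (M : set X) (T : X -> X) : set R[i] :=
  [set l | ~ invertible M (fun x => T x - l *: x)].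

Definition quasi_nilpotent (R : realType) (X : normedModType R[i])
    (M : set X) (T : X -> X) : Prop :=
  spectrum M T `<=` [set 0].

Definition decomposition (R : realType) (X : normedModType R[i])
    (T : X -> X) (M N : set X) : Prop :=
  [/\ closed_subspace M, closed_subspace N, invariant T M, invariant T N &
    (forall x, exists y z, [/\ M y, N z & x = y + z]) /\
    M `&` N = [set 0]].

Definition pseudo_B_fredholm (R : realType) (X : normedModType R[i])
    (T : X -> X) : Prop :=
  exists M N : set X,
    [/\ decomposition T M N, fredholm M T & quasi_nilpotent N T].

Definition pseudo_fredholm (R : realType) (X : normedModType R[i])
    (T : X -> X) : Prop :=
  exists M N : set X,
    [/\ decomposition T M N, kato M T & quasi_nilpotent N T].

(* Main.v *)
(** Suppose a vector [u] of the kernel of [T|M] lies in [R(T^m)] but not in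
    [R(T^(m+1))], say [u = T^m v] with [v] in [M]. As [R(T^(m+1))] has finite
    codimension, the open mapping theorem gives a bounded functional [phi] with
    [phi u = 1] vanishing on [T^(m+1) M + N]. After correcting [v], the
    functionals [phi \o T^j] are dual to the Jordan chain [v, T v, ..., T^m v],
    so that the span of the chain is the range of a bounded projection commuting
    with [T]. Moving this nilpotent block from [M] to [N] keeps [T|M] Fredholm
    and [T|N] quasi-nilpotent and lowers the dimension of the kernel of [T|M].
    When no such [u] is left, [T|M] is a Kato operator; its range is closed by
    the same separation argument. *)
From HB Require Import structures.
Require Import Defs.
From mathcomp Require Import all_boot all_order all_algebra.
From mathcomp Require Import all_classical all_reals all_analysis.
From mathcomp Require Import ring lra zify.
Import Order.TTheory GRing.Theory Num.Theory numFieldNormedType.Exports.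

Set Implicit Arguments.
Unset Strict Implicit.
Unset Printing Implicit Defensive.

Local Open Scope classical_set_scope.
Local Open Scope complex_scope.
Local Open Scope ring_scope.

(** * Norms as real numbers *)

(** Norms take values in [R[i]], where the order is only partial. The real part loses nothing
    ([normE]) and allows arithmetic in [R]. *)
Definition rnorm (R : realType) (V : normedZmodType R[i]) (x : V) : R :=
  complex.Re `|x|.

Section RealNorm.
Variables (R : realType) (V : normedZmodType R[i]).
Implicit Types x y : V.

Lemma normE x : `|x| = (rnorm x)%:C.
Proof. by rewrite /rnorm RRe_real ?normr_real. Qed.

Lemma rnorm_ge0 x : 0 <= rnorm x.
Proof. by rewrite -ler0c -normE. Qed.

Lemma rnorm0 : rnorm (0 : V) = 0.
Proof. by rewrite /rnorm normr0. Qed.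

Lemma rnorm0_eq0 x : rnorm x = 0 -> x = 0.
Proof. by move=> h; apply/normr0_eq0; rewrite normE h. Qed.

Lemma rnorm_gt0 x : x != 0 -> 0 < rnorm x.
Proof.
move=> x0; rewrite lt_neqAle rnorm_ge0 andbT.
by apply: contraNneq x0 => /esym/rnorm0_eq0 ->.
Qed.

Lemma ler_rnormD x y : rnorm (x + y) <= rnorm x + rnorm y.
Proof. by rewrite -lecR rmorphD /= -!normE ler_normD. Qed.

Lemma rnormN x : rnorm (- x) = rnorm x.
Proof. by rewrite /rnorm normrN. Qed.

Lemma rnormBC x y : rnorm (x - y) = rnorm (y - x).
Proof. by rewrite -rnormN opprB. Qed.

Lemma ler_rnormB x y : rnorm (x - y) <= rnorm x + rnorm y.
Proof. by rewrite -[rnorm y]rnormN ler_rnormD. Qed.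

Lemma ler_rdistD z x y : rnorm (x - y) <= rnorm (x - z) + rnorm (z - y).
Proof. by rewrite -[x - y](subrKA z) ler_rnormD. Qed.

End RealNorm.

Lemma rnormZ (R : realType) (V : normedModType R[i]) (c : R[i]) (x : V) :
  rnorm (c *: x) = rnorm c * rnorm x.
Proof. by apply: complexI; rewrite rmorphM /= -!normE normrZ. Qed.

Lemma rnormM (R : realType) (c d : R[i]) : rnorm (c * d) = rnorm c * rnorm d.
Proof. by apply: complexI; rewrite rmorphM /= -!normE normrM. Qed.

Lemma rnormV (R : realType) (c : R[i]) : rnorm c^-1 = (rnorm c)^-1.
Proof. by apply: complexI; rewrite fmorphV /= -!normE normfV. Qed.

Lemma rnorm1 (R : realType) : rnorm (1 : R[i]) = 1.
Proof. by rewrite /rnorm normr1. Qed.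

Lemma rnorm_real (R : realType) (r : R) : 0 <= r -> rnorm (r%:C) = r.
Proof. by move=> r0; rewrite /rnorm ger0_norm ?ler0c. Qed.

(** Since [n + 2 <= 2 * (n + 1)], halving keeps [r n * (n + 1)] below [r 0], and [R] is
    archimedean. *)
Lemma halving_decay (R : realType) (r : nat -> R) :
  (forall n, 0 <= r n) -> (forall n, r n.+1 <= r n / 2) ->
  forall e, 0 < e -> exists n, r n < e.
Proof.
move=> r0 hr e e0.
have H n : r n * n.+1%:R <= r 0%N.
  elim: n => [|n IH]; first by rewrite mulr1.
  have := hr n; have := r0 n.+1; have := r0 n.
  have : (n.+2%:R : R) <= 2 * n.+1%:R by rewrite -natrM ler_nat; lia.
  have : (0 : R) <= n.+1%:R by [].
  by move: (n.+1%:R : R) (n.+2%:R : R) IH => a b *; nra.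
exists (Num.truncn (r 0%N / e)).
have := truncnS_gt (r 0%N / e); rewrite ltr_pdivrMr // => h.
have := H (Num.truncn (r 0%N / e)).
set k := _.+1 in h *; have : (0 : R) < k%:R by rewrite ltr0n.
move: (k%:R : R) h => a; nra.
Qed.

Lemma gtr0c (R : realType) (r : R) : (0 < r%:C) = (0 < r).
Proof. by rewrite -ltcR. Qed.

Lemma gt0_complexP (R : realType) (e : R[i]) :
  0 < e -> exists2 r : R, 0 < r & e = r%:C.
Proof.
move=> e0; have eE : (complex.Re e)%:C = e by rewrite RRe_real ?gtr0_real.
by exists (complex.Re e); rewrite // -gtr0c eE.
Qed.

(** * Completeness and the Baire category theorem *)

Section NestedLimit.
Variables (R : realType) (X : completeNormedModType R[i]).
Implicit Types (A : set X) (x y : X).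

Lemma ballE x (e : R) y : ball x e%:C y <-> rnorm (x - y) < e.
Proof. by rewrite -ball_normE /ball_ /= normE ltcR. Qed.

Lemma closedP A :
  closed A <->
  forall x, (forall e : R, 0 < e -> exists2 a, A a & rnorm (x - a) < e) -> A x.
Proof.
split=> [clA x h|h x clx].
  apply: clA => B /nbhs_ballP[e /= e0].
  have [r r0 ->] := gt0_complexP e0; move=> sub.
  by have [a Aa /ballE xa] := h _ r0; exists a; split=> //; exact: sub.
apply: h => e e0; have [] := clx (ball x e%:C).
  by apply: nbhsx_ballx; rewrite gtr0c.
by move=> a [Aa /ballE]; exists a.
Qed.

(** The closed balls of centre [u n] and radius [r n] are nested, so the centres form a Cauchy
    sequence whose limit lies in every ball. *)
Lemma nested_limit (u : nat -> X) (r : nat -> R) :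
  (forall n, 0 <= r n) -> (forall n, r n.+1 <= r n / 2) ->
  (forall n, rnorm (u n.+1 - u n) <= r n / 2) ->
  exists l, forall n, rnorm (l - u n) <= r n.
Proof.
move=> r0 hr hu.
have step n k : rnorm (u (n + k)%N - u n) + r (n + k)%N <= r n.
  elim: k => [|k IH]; first by rewrite addn0 subrr rnorm0 add0r.
  rewrite addnS; have := ler_rdistD (u (n + k)%N) (u (n + k).+1) (u n).
  by have := hu (n + k)%N; have := hr (n + k)%N; lra.
have near_u n m : (n <= m)%N -> rnorm (u m - u n) <= r n.
  by move=> /subnKC <-; have := step n (m - n)%N; have := r0 (n + (m - n))%N; lra.
have : cvgn u.
  apply: cauchy_cvg; apply: cauchy_exP => e e0.
  have [d d0 ->] := gt0_complexP e0.
  have [n rn] := halving_decay r0 hr d0.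
  exists (u n), n => // m /= nm; apply/ballE.
  by rewrite rnormBC; apply: le_lt_trans rn; exact: near_u.
move=> /cvg_ex[/= l /cvgrPdist_lt hl]; exists l => n.
apply/ler_addgt0Pr => e e0.
have [|m _ hm] := hl e%:C; first by rewrite gtr0c.
have := hm (maxn m n) (leq_maxl _ _); rewrite /= normE ltcR => h1.
have := near_u n (maxn m n) (leq_maxr _ _).
by have := ler_rdistD (u (maxn m n)) l (u n); lra.
Qed.

(** Otherwise every ball contains one of at most half the radius that misses a given [D k]; the
    common point of a nested sequence of such balls lies in no [D k]. *)
Lemma baire_somewhere_dense (D : nat -> set X) :
  (forall x, exists k, D k x) ->
  exists k x0 (r : R), 0 < r /\ forall y, rnorm (y - x0) <= r ->
    forall e, 0 < e -> exists2 z, D k z & rnorm (y - z) < e.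
Proof.
move=> cover; apply: contrapT => noball.
have hole (p : nat * (X * R)) : exists q : X * R, 0 < p.2.2 ->
    [/\ 0 < q.2, q.2 <= p.2.2 / 2, rnorm (q.1 - p.2.1) <= p.2.2 / 2 &
      forall z, rnorm (z - q.1) <= q.2 -> ~ D p.1 z].
  case: p => k [x r] /=.
  (* The pair returned for a nonpositive radius is a dummy that makes [hole] total, as [choice]
     requires. *)
  have [r0|] := ltP 0 r; last by move=> r0; exists (x, r).
  apply: contrapT => /forallNP H; apply: noball; exists k, x, (r / 2).
  split=> [|y yx e e0]; first by lra.
  apply: contrapT => far.
  (* The bound [e / 2] keeps the new ball within the hole around [y]; [r / 2] gives the halving. *)
  have m0 : 0 < Num.min (e / 2) (r / 2) by rewrite lt_min; apply/andP; split; lra.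
  have mr : Num.min (e / 2) (r / 2) <= r / 2 by rewrite ge_min lexx orbT.
  have me : Num.min (e / 2) (r / 2) <= e / 2 by rewrite ge_min lexx.
  apply: (H (y, Num.min (e / 2) (r / 2))) => _; split=> //= z zy Dz.
  by apply: far; exists z => //; rewrite rnormBC; lra.
have [next nextP] := choice hole.
(* Ball number [m.+1] misses [D m]. *)
pose fix s n : X * R := if n is m.+1 then next (m, s m) else (0, 1).
have s0 n : 0 < (s n).2 by elim: n => //= n IH; case: (nextP (n, s n) IH).
have sP n := nextP (n, s n) (s0 n).
have [l hl] : exists l, forall n, rnorm (l - (s n).1) <= (s n).2.
  apply: nested_limit => n; [exact: ltW|by case: (sP n)|by case: (sP n)].
have [k Dk] := cover l; case: (sP k) => _ _ _ /(_ l (hl k.+1)).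
exact.
Qed.

End NestedLimit.

(** * Bounded maps and closed subspaces *)

Definition bounded_map (R : realType) (V W : normedZmodType R[i]) (f : V -> W) :=
  exists2 C : R, 0 <= C & forall x, rnorm (f x) <= C * rnorm x.

Section Subspaces.
Variables (R : realType) (X : normedModType R[i]).
Implicit Types (A : set X).

Lemma closed_lin_subspaceP A :
  closed_subspace A <->
  [/\ closed A, A 0 & forall (c : R[i]) x y, A x -> A y -> A (c *: x + y)].
Proof.
split=> [[clA [A0 Alin]]|[clA A0 Alin]]; split=> //.
- by move: A0; rewrite !inE.
- by move=> c x y Ax Ay; have := Alin c x y; rewrite !inE; apply.
- by split=> [|c x y]; rewrite !inE => //; exact: Alin.
Qed.

Variable A : set X.
Hypothesis Asub : closed_subspace A.

Lemma subspace0 : A 0.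
Proof. by have /closed_lin_subspaceP[] := Asub. Qed.

Lemma subspaceD x y : A x -> A y -> A (x + y).
Proof.
by have /closed_lin_subspaceP[_ _ h] := Asub => Ax Ay; rewrite -[x]scale1r; exact: h.
Qed.

Lemma subspaceZ (c : R[i]) x : A x -> A (c *: x).
Proof.
have /closed_lin_subspaceP[_ A0 h] := Asub => Ax.
by rewrite -[c *: x]addr0; exact: h.
Qed.

Lemma subspaceN x : A x -> A (- x).
Proof. by rewrite -scaleN1r; exact: subspaceZ. Qed.

Lemma subspaceB x y : A x -> A y -> A (x - y).
Proof. by move=> Ax Ay; apply: subspaceD => //; exact: subspaceN. Qed.

Lemma subspace_sum n (f : 'I_n -> X) :
  (forall i, A (f i)) -> A (\sum_(i < n) f i).
Proof.
by move=> Af; apply: (big_ind A) => //; [exact: subspace0|exact: subspaceD].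
Qed.

End Subspaces.

(** * The open mapping theorem for a sum [S A + B] *)

Section OpenMapping.
Variables (R : realType) (X : completeNormedModType R[i]).

Lemma subspace_lim (A : set X) x : closed_subspace A ->
  (forall e : R, 0 < e -> exists2 a, A a & rnorm (x - a) < e) -> A x.
Proof. by case=> /closedP clA _ /clA. Qed.

(* By Baire, [x = S a + b] can be solved up to an error of half the norm of [x];
   iterating on the error and summing the corrections gives an exact solution. *)
Lemma open_mapping (A B : set X) (S : {linear X -> X}) :
  closed_subspace A -> closed_subspace B -> bounded_map S ->
  (forall x, exists a b, [/\ A a, B b & x = S a + b]) ->
  exists2 K : R, 0 <= K & forall x, exists a b,
    [/\ A a, B b, x = S a + b & rnorm b <= K * rnorm x].
Proof.
move=> sA sB [C C0 SC] onto.
pose D (k : nat) : set X := [set x | exists a b,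
  [/\ A a, B b, x = S a + b, rnorm a <= k%:R & rnorm b <= k%:R]].
have [x|k [x0 [r [r0 dense_ball]]]] := @baire_somewhere_dense R X D.
  have [a [b [Aa Bb ->]]] := onto x.
  exists (Num.truncn (rnorm a + rnorm b)).+1, a, b.
  have := truncnS_gt (rnorm a + rnorm b).
  by have := rnorm_ge0 a; have := rnorm_ge0 b; split=> //; lra.
(* Subtracting an approximation of [x0] from one of [x0 + y] recentres the ball at the origin, at
   the cost of doubling the bound [k]. *)
have approx0 y e : rnorm y <= r -> 0 < e -> exists ab : X * X,
    [/\ A ab.1, B ab.2, rnorm (y - (S ab.1 + ab.2)) < e,
      rnorm ab.1 <= 2 * k%:R & rnorm ab.2 <= 2 * k%:R].
  move=> yr e0.
  have [||_ [a1 [b1 [Aa1 Bb1 -> a1k b1k]]] z1] := dense_ball (x0 + y) _ (e / 2).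
  - by rewrite addrC addKr.
  - by lra.
  have [||_ [a2 [b2 [Aa2 Bb2 -> a2k b2k]]] z2] := dense_ball x0 _ (e / 2).
  - by rewrite subrr rnorm0; lra.
  - by lra.
  exists (a1 - a2, b1 - b2); split=> /=.
  - exact: subspaceB.
  - exact: subspaceB.
  - have -> : y - (S (a1 - a2) + (b1 - b2)) =
        (x0 + y - (S a1 + b1)) - (x0 - (S a2 + b2)).
      by rewrite linearB addrACA -opprD !opprB -[x0 + y - _]addrA [RHS]addrC
        subrKA addrCA.
    by apply: le_lt_trans (ler_rnormB _ _) _; lra.
  - by have := ler_rnormB a1 a2; lra.
  - by have := ler_rnormB b1 b2; lra.
(* A nonzero [y] is scaled to norm [r]; scaling back multiplies the bound [2 * k] by
   [rnorm y / r]. *)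
pose K := 2 * k%:R / r.
have K0 : 0 <= K by rewrite /K divr_ge0 ?mulr_ge0 // ltW.
have approx y : exists ab : X * X,
    [/\ A ab.1, B ab.2, rnorm (y - (S ab.1 + ab.2)) <= rnorm y / 2,
      rnorm ab.1 <= K * rnorm y & rnorm ab.2 <= K * rnorm y].
  have [->|y0] := eqVneq y 0.
    exists (0, 0); rewrite /= linear0 addr0 subrr rnorm0 mulr0 mul0r.
    by split=> //; exact: subspace0.
  have ny := rnorm_gt0 y0; set t := r / rnorm y.
  have t0 : 0 < t by rewrite divr_gt0.
  have tc0 : t%:C != 0 by rewrite gt_eqF ?gtr0c.
  have [||[a b] /= [Aa Bb ab ak bk]] := approx0 (t%:C *: y) (r / 2).
  - by rewrite rnormZ rnorm_real ?(ltW t0) // /t divfK ?gt_eqF.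
  - by lra.
  have tV : t^-1 = rnorm y / r by rewrite /t invf_div.
  have nV z : rnorm (t%:C^-1 *: z) = rnorm y / r * rnorm z.
    by rewrite rnormZ rnormV rnorm_real ?tV // ltW.
  have nVK z : rnorm z <= 2 * k%:R -> rnorm (t%:C^-1 *: z) <= K * rnorm y.
    rewrite nV /K => zk.
    rewrite (_ : 2 * _ / r * _ = rnorm y / r * (2 * k%:R)); last by ring.
    by rewrite ler_wpM2l // divr_ge0 // ltW.
  exists (t%:C^-1 *: a, t%:C^-1 *: b); split=> /=.
  - exact: subspaceZ.
  - exact: subspaceZ.
  - have -> : y - (S (t%:C^-1 *: a) + t%:C^-1 *: b) =
        t%:C^-1 *: (t%:C *: y - (S a + b)).
      by rewrite linearZ /= scalerBr scalerA mulVf // scale1r scalerDr.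
    rewrite nV (_ : rnorm y / 2 = rnorm y / r * (r / 2)); last by field; lra.
    by rewrite ler_wpM2l ?divr_ge0 ?ltW.
  - exact: nVK.
  - exact: nVK.
clearbody K; have [f fP] := choice approx.
exists (2 * K); first by rewrite mulr_ge0.
move=> y.
(* The state holds the remaining error, then the partial sums of the corrections in [A] and in
   [B]. *)
pose fix s n : X * (X * X) := if n is m.+1 then
  let: (ym, (am, bm)) := s m in
  (ym - (S (f ym).1 + (f ym).2), (am + (f ym).1, bm + (f ym).2)) else (y, (0, 0)).
have sS n : s n.+1 = ((s n).1 - (S (f (s n).1).1 + (f (s n).1).2),
    ((s n).2.1 + (f (s n).1).1, (s n).2.2 + (f (s n).1).2)).
  by rewrite /=; case: (s n) => ? [].
have half n : rnorm (s n.+1).1 <= rnorm (s n).1 / 2.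
  by rewrite sS /=; case: (fP (s n).1).
have sA' n : A (s n).2.1.
  elim: n => [|n IH]; first exact: subspace0.
  by rewrite sS /=; apply: subspaceD => //; case: (fP (s n).1).
have sB' n : B (s n).2.2.
  elim: n => [|n IH]; first exact: subspace0.
  by rewrite sS /=; apply: subspaceD => //; case: (fP (s n).1).
have sE n : y = S (s n).2.1 + (s n).2.2 + (s n).1.
  elim: n => [|n IH]; first by rewrite /= linear0 !add0r.
  rewrite sS /= linearD [S _ + S _ + _]addrACA.
  by set w := S (f _).1 + _; rewrite -(addrA _ w) [w + _]addrC subrK.
(* A correction is at most [K] times the current error, which is [rad n / 2] as [nested_limit] asks;
   [rad 0] is the final bound on [b]. *)
pose rad n := 2 * K * rnorm (s n).1.
have rad0 n : 0 <= rad n by rewrite /rad mulr_ge0 ?rnorm_ge0 ?mulr_ge0.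
have radS n : rad n.+1 <= rad n / 2.
  by rewrite /rad -[leRHS]mulrA ler_wpM2l ?mulr_ge0.
have radE n : rad n / 2 = K * rnorm (s n).1 by rewrite /rad; field.
have [a ha] : exists a, forall n, rnorm (a - (s n).2.1) <= rad n.
  apply: nested_limit => // n.
  by rewrite sS /= addrAC subrr add0r radE; case: (fP (s n).1).
have [b hb] : exists b, forall n, rnorm (b - (s n).2.2) <= rad n.
  apply: nested_limit => // n.
  by rewrite sS /= addrAC subrr add0r radE; case: (fP (s n).1).
have small := halving_decay rad0 radS.
exists a, b; split.
- apply: subspace_lim sA _ => e /small[n hn].
  by exists (s n).2.1 => //; exact: le_lt_trans hn.
- apply: subspace_lim sB _ => e /small[n hn].
  by exists (s n).2.2 => //; exact: le_lt_trans hn.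
- apply/eqP; rewrite -subr_eq0; apply/eqP/rnorm0_eq0/eqP.
  rewrite eq_le rnorm_ge0 andbT; apply/ler_addgt0Pr => e e0; rewrite add0r.
  (* This bounds the residue of the limits: the error at stage [n], plus [C * rad n] from [a] and
     [rad n] from [b]. *)
  pose rad' n := (C + 1) * rad n + rnorm (s n).1.
  have [||n hn] := @halving_decay _ rad' _ _ _ e0.
  + by move=> n; rewrite /rad' addr_ge0 ?rnorm_ge0 // mulr_ge0 ?rad0 //; lra.
  + move=> n; rewrite /rad'; have := half n.
    have : (C + 1) * rad n.+1 <= (C + 1) * (rad n / 2) by rewrite ler_wpM2l //; lra.
    by lra.
  have -> : y - (S a + b) = (s n).1 - (S (a - (s n).2.1) + (b - (s n).2.2)).
    by rewrite {1}(sE n) linearB [S a - _ + _]addrACA -opprD opprB addrA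
      [(s n).1 + _]addrC.
  apply: le_trans (ler_rnormB _ _) _.
  have := ler_rnormD (S (a - (s n).2.1)) (b - (s n).2.2).
  have := SC (a - (s n).2.1); have := ha n; have := hb n.
  have : C * rnorm (a - (s n).2.1) <= C * rad n by rewrite ler_wpM2l.
  by move: hn; rewrite /rad'; lra.
- by have := hb 0%N; rewrite /= subr0.
Qed.

End OpenMapping.

(** * Limits of complex scalars *)

Section ComplexModulus.
Variable R : realType.
Implicit Types z : R[i].

Lemma rnormi : rnorm ('i%C : R[i]) = 1.
Proof. by rewrite /rnorm normc_def /= expr0n expr1n add0r sqrtr1. Qed.

Lemma ler_Re_rnorm z : `|complex.Re z| <= rnorm z.
Proof. by rewrite -lecR -normE; exact: normc_ge_Re. Qed.

Lemma ler_Im_rnorm z : `|complex.Im z| <= rnorm z.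
Proof.
by have := ler_Re_rnorm (z * 'i%C); rewrite ReiNIm normrN rnormM rnormi mulr1.
Qed.

Lemma rnorm_le_ReIm z : rnorm z <= `|complex.Re z| + `|complex.Im z|.
Proof.
rewrite {1}[z]complexE; apply: le_trans (ler_rnormD _ _) _.
rewrite rnormM rnormi mul1r.
by rewrite /rnorm !normc_def /= !expr0n !addr0 !sqrtr_sqr.
Qed.

End ComplexModulus.

Section ScalarLimits.
Variables (R : realType) (r : nat -> R).
Hypotheses (r0 : forall n, 0 <= r n) (rS : forall n, r n.+1 <= r n / 2).

(** The intervals [[u n - r n, u n + r n]] are nested, so the supremum of their left ends lies in
    all of them. *)
Lemma nested_limit_real (u : nat -> R) :
  (forall n, `|u n.+1 - u n| <= r n / 2) ->
  exists l, forall n, `|l - u n| <= r n.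
Proof.
move=> hu.
have low n k : u n - r n <= u (n + k)%N - r (n + k)%N.
  elim: k => [|k IH]; first by rewrite addn0.
  rewrite addnS; have := hu (n + k)%N; have := rS (n + k)%N.
  by rewrite ler_norml; lra.
have up n k : u (n + k)%N + r (n + k)%N <= u n + r n.
  elim: k => [|k IH]; first by rewrite addn0.
  rewrite addnS; have := hu (n + k)%N; have := rS (n + k)%N.
  by rewrite ler_norml; lra.
have lowup n m : u n - r n <= u m + r m.
  have := low n m; have := up m n; rewrite [(m + n)%N]addnC.
  by have := r0 (n + m)%N; lra.
pose E := range (fun n => u n - r n).
have hE : has_sup E.
  split; first by exists (u 0%N - r 0%N), 0%N.
  by exists (u 0%N + r 0%N) => _ [n _ <-]; exact: lowup.
exists (sup E) => n; rewrite ler_distl; apply/andP; split.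
  by apply: sup_upper_bound => //; exists n.
by apply: ge_sup; [case: hE|move=> _ [m _ <-]; exact: lowup].
Qed.

Lemma nested_limit_complex (c : nat -> R[i]) :
  (forall n, rnorm (c n.+1 - c n) <= r n / 2) ->
  exists l, forall n, rnorm (l - c n) <= 2 * r n.
Proof.
move=> hc.
have [n|a ha] := @nested_limit_real (fun n => complex.Re (c n)).
  apply: le_trans (hc n); apply: le_trans (ler_Re_rnorm _).
  by case: (c n) (c n.+1) => ? ? [].
have [n|b hb] := @nested_limit_real (fun n => complex.Im (c n)).
  apply: le_trans (hc n); apply: le_trans (ler_Im_rnorm _).
  by case: (c n) (c n.+1) => ? ? [].
exists (a +i* b) => n; apply: le_trans (rnorm_le_ReIm _) _.
by have := ha n; have := hb n; rewrite /=; case: (c n) => ? ? /=; lra.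
Qed.

End ScalarLimits.

(** * Enlarging a closed subspace by a line *)

Definition add_line (R : realType) (X : normedModType R[i]) (B : set X) (u : X)
    : set X :=
  [set x | exists c : R[i], B (x - c *: u)].

Section AddLine.
Variables (R : realType) (X : completeNormedModType R[i]).

(** As [B] is closed, [u] has positive distance from it, and scaling extends this to all multiples
    of [u]. The coefficient of [u] is thus a bounded function on [B + C u]. *)
Lemma distance_to_subspace (B : set X) (u : X) :
  closed_subspace B -> ~ B u ->
  exists2 d : R, 0 < d &
    forall b (c : R[i]), B b -> d * rnorm c <= rnorm (b + c *: u).
Proof.
move=> sB nBu.
have [d d0 far] : exists2 d : R, 0 < d & forall b, B b -> d <= rnorm (u - b).
  apply: contrapT => H; apply: nBu; apply: subspace_lim sB _ => e e0.
  apply: contrapT => G; apply: H; exists e => // b Bb.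
  by rewrite leNgt; apply/negP => lt; apply: G; exists b.
exists d => // b c Bb; have [->|c0] := eqVneq c 0.
  by rewrite rnorm0 mulr0 rnorm_ge0.
have -> : b + c *: u = c *: (u - (- c^-1) *: b).
  by rewrite scalerBr scaleNr scalerN opprK scalerA mulfV // scale1r addrC.
by rewrite rnormZ mulrC ler_wpM2l ?rnorm_ge0 // far //; exact: subspaceZ.
Qed.

(** By [distance_to_subspace], the coefficients of [u] in approximants of [x] converge; removing the
    limit multiple of [u] from [x] leaves a limit of points of [B]. *)
Lemma closed_add_line (B : set X) (u : X) :
  closed_subspace B -> closed_subspace (add_line B u).
Proof.
move=> sB; have [Bu|nBu] := pselect (B u).
  suff -> : add_line B u = B by [].
  apply/seteqP; split=> x => [[c Bx]|Bx]; last by exists 0; rewrite scale0r subr0.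
  by rewrite -[x](subrK (c *: u)); apply: subspaceD => //; exact: subspaceZ.
apply/closed_lin_subspaceP; split; last first.
- move=> k x y [c Bx] [d By]; exists (k * c + d).
  rewrite scalerDl opprD addrACA -scalerA -scalerBr.
  by apply: subspaceD => //; exact: subspaceZ.
- by exists 0; rewrite scale0r subr0; exact: subspace0.
apply/closedP => x hx.
have [d d0 hd] := distance_to_subspace sB nBu.
pose e n : R := 2^-1 ^+ n.
have e0 n : 0 < e n by rewrite exprn_gt0 // invr_gt0.
have eS n : e n.+1 = e n / 2 by rewrite /e exprSr.
have approx n : exists c : R[i], exists2 b, B b & rnorm (x - (b + c *: u)) < e n.
  have [a [c Ba] xa] := hx _ (e0 n); exists c, (a - c *: u) => //.
  by rewrite subrK.
have [c cP] := choice approx.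
(* Successive approximants differ by at most [2 * e n], hence their coefficients by at most
   [2 * e n / d], which is [rad n / 2]. *)
pose rad n := 4 / d * e n.
have rad0 n : 0 <= rad n by rewrite /rad !mulr_ge0 ?invr_ge0 // ltW.
have radS n : rad n.+1 <= rad n / 2 by rewrite /rad eS mulrA.
have [l hl] : exists l, forall n, rnorm (l - c n) <= 2 * rad n.
  apply: nested_limit_complex => // n.
  have [b Bb hb] := cP n; have [b' Bb' hb'] := cP n.+1.
  have := hd (b' - b) (c n.+1 - c n) (subspaceB sB Bb' Bb).
  rewrite scalerBl addrACA -opprD => h.
  have := ler_rdistD x (b' + c n.+1 *: u) (b + c n *: u).
  rewrite [rnorm (_ - x)]rnormBC => h'; have h2 : d * rnorm (c n.+1 - c n) <= 2 * e n.
    by have := eS n; have := e0 n; lra.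
  rewrite (_ : rad n / 2 = 2 * e n / d); last by rewrite /rad; field; lra.
  by rewrite ler_pdivlMr // mulrC.
exists l; apply: subspace_lim sB _ => t t0.
pose rad' n := e n + 2 * rnorm u * rad n.
have u0 := rnorm_ge0 u.
have [||n hn] := @halving_decay _ rad' _ _ _ t0.
- by move=> n; rewrite /rad' addr_ge0 ?(ltW (e0 n)) // mulr_ge0 ?rad0 ?mulr_ge0.
- move=> n; rewrite /rad' eS /rad eS; lra.
have [b Bb hb] := cP n; exists b => //; apply: le_lt_trans hn.
have -> : x - l *: u - b = (x - (b + c n *: u)) - (l - c n) *: u.
  by rewrite scalerBl opprB opprD !addrA subrK addrAC.
apply: le_trans (ler_rnormB _ _) _; rewrite rnormZ /rad'.
have : rnorm (l - c n) * rnorm u <= 2 * rad n * rnorm u by rewrite ler_wpM2r.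
by move: hb; lra.
Qed.

End AddLine.

(** * Separation by a bounded functional *)

Definition range_add (R : realType) (X : normedModType R[i]) (S : X -> X)
    (A B : set X) : set X :=
  [set x | exists a b, [/\ A a, B b & x = S a + b]].

Section Separation.
Variables (R : realType) (X : completeNormedModType R[i]).
Variables (A : set X) (S : {linear X -> X}).
Hypotheses (sA : closed_subspace A) (bS : bounded_map S).

Lemma range_add_linear (B : set X) (c : R[i]) x y : closed_subspace B ->
  range_add S A B x -> range_add S A B y -> range_add S A B (c *: x + y).
Proof.
move=> sB [a [b [Aa Bb ->]]] [a' [b' [Aa' Bb' ->]]].
exists (c *: a + a'), (c *: b + b'); split.
- by apply: subspaceD => //; exact: subspaceZ.
- by apply: subspaceD => //; exact: subspaceZ.
- by rewrite linearP scalerDr addrACA.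
Qed.

(** The value [phi x] is the coefficient of [u] modulo [S A + B], unique because [u] lies outside.
    [S A + B] is not assumed closed: open mapping for [A] and [B + C u] bounds the component
    [b + c *: u] by [x], and [distance_to_subspace] bounds [c] by that component. *)
Lemma range_add_separation_line (B : set X) (u : X) :
  closed_subspace B -> ~ range_add S A B u ->
  (forall x, exists c : R[i], range_add S A B (x - c *: u)) ->
  exists phi : {scalar X}, [/\ bounded_map phi,
    forall x, range_add S A B x -> phi x = 0 & phi u = 1].
Proof.
move=> sB nHu span; set H := range_add S A B in nHu span *.
have H0 : H 0 by exists 0, 0; rewrite linear0 addr0; split => //; exact: subspace0.
have HP (c : R[i]) x y : H x -> H y -> H (c *: x + y) by exact: range_add_linear.
have uniq (c d : R[i]) x : H (x - c *: u) -> H (x - d *: u) -> c = d.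
  move=> Hc Hd; apply/eqP; rewrite eq_sym -subr_eq0.
  apply/negPn/negP => dc; apply: nHu.
  have -> : u = (d - c)^-1 *: (-1 *: (x - d *: u) + (x - c *: u)) + 0.
    by rewrite addr0 scaleN1r opprB subrKA -scalerBl scalerA mulVf // scale1r.
  by apply: (HP) => //; exact: HP.
have [f fP] := choice span.
have flin : scalar f.
  move=> c x y; apply: (uniq _ _ (c *: x + y)) => //.
  rewrite scalerDl -scalerA opprD addrACA -scalerBr; exact: HP.
pose phi : {scalar X} :=
  HB.pack f (GRing.isLinear.Build R[i] X R[i]^o *%R f flin).
exists phi; split; last 2 first.
- by move=> x Hx; apply: (uniq _ _ x) => //; rewrite scale0r subr0.
- by apply: (uniq _ _ u) => //; rewrite scale1r subrr.
have nBu : ~ B u.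
  move=> Bu; apply: nHu; exists 0, u.
  by rewrite linear0 add0r; split => //; exact: subspace0.
have [d d0 hd] := distance_to_subspace sB nBu.
have [x|K K0 hK] := open_mapping sA (closed_add_line u sB) bS.
  have [c [a [b [Aa Bb xE]]]] := span x; exists a, (b + c *: u); split=> //.
    by exists c; rewrite addrK.
  by rewrite addrA -xE subrK.
exists (K / d); first by rewrite divr_ge0 // ltW.
move=> x; have [a [b [Aa [c Bb] xE bx]]] := hK x.
have -> : phi x = c.
  apply: (uniq _ _ x) => //; exists a, (b - c *: u); split=> //.
  by rewrite {1}xE addrA.
have := hd _ c Bb; rewrite subrK => h.
rewrite mulrAC ler_pdivlMr // mulrC; exact: le_trans bx.
Qed.

(* Directions [e i] outside [S A + B + C u] are absorbed in [B]; the others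
   are redundant. *)
Lemma range_add_separation n (e : 'I_n -> X) (B : set X) (u : X) :
  closed_subspace B -> ~ range_add S A B u ->
  (forall x, exists (d : R[i]) (c : 'I_n -> R[i]),
    range_add S A B (x - d *: u - \sum_(i < n) c i *: e i)) ->
  exists phi : {scalar X}, [/\ bounded_map phi,
    forall x, range_add S A B x -> phi x = 0 & phi u = 1].
Proof.
elim: n e B => [|n IH] e B sB nHu span.
  apply: range_add_separation_line => // x; have [d [c]] := span x.
  by rewrite big_ord0 subr0; exists d.
pose e0 := e ord0; pose e' := e \o lift ord0.
have [[a [b [Aa [k Bb] uE]]]|nHu'] := pselect (range_add S A (add_line B e0) u).
  (* Here [e0] is a combination of [u] and an element of [S A + B], so its coefficient is
     transferred to [u]. *)
  have k0 : k != 0.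
    apply/eqP => k0; apply: nHu; exists a, b; split=> //.
    by move: Bb; rewrite k0 scale0r subr0.
  apply: (IH e' B sB nHu) => x; have [d [c]] := span x.
  rewrite big_ord_recl -/e0 => Hx.
  exists (d + c ord0 / k), (c \o lift ord0) => /=.
  have -> : x - (d + c ord0 / k) *: u - \sum_(i < n) c (lift ord0 i) *: e' i =
      - (c ord0 / k) *: (S a + (b - k *: e0)) +
      (x - d *: u - (c ord0 *: e0 + \sum_(i < n) c (lift ord0 i) *: e' i)).
    rewrite [S a + _]addrA -uE scalerBr scalerA mulNr divfK // !scaleNr opprK.
    rewrite scalerDl !opprD.
    set p := (_ / _) *: u; set q := c ord0 *: e0; set s := \sum_(i < n) _.
    by rewrite [RHS]addrACA [q + _]addrA subrr add0r addrA [- p + _]addrC.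
  by apply: range_add_linear => //; exists a, (b - k *: e0); split.
(* Here [u] stays outside after [e0] joins [B]; the functional found vanishes on the larger sum. *)
have [x|phi [bphi phi0 phiu]] := IH e' _ (closed_add_line e0 sB) nHu'.
  have [d [c]] := span x; rewrite big_ord_recl -/e0 => -[a [b [Aa Bb xE]]].
  exists d, (c \o lift ord0), a, (b + c ord0 *: e0); split=> //=.
    by exists (c ord0); rewrite addrK.
  by rewrite addrA -xE opprD addrA addrAC subrK.
exists phi; split=> // x [a [b [Aa Bb ->]]]; apply: phi0.
by exists a, b; split=> //; exists 0; rewrite scale0r subr0.
Qed.

End Separation.

(** * Iterates and the calculus of bounded maps *)

Lemma iter_is_linear (K : nzRingType) (V : lmodType K) (T : {linear V -> V}) n :
  linear (iter n T).
Proof. by move=> c x y; elim: n => //= n ->; rewrite linearP. Qed.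

HB.instance Definition _ (K : nzRingType) (V : lmodType K) (T : {linear V -> V}) n :=
  GRing.isLinear.Build K V V *:%R (iter n T) (iter_is_linear T n).

Lemma bounded_operatorP (R : realType) (X : normedModType R[i]) (M : set X)
    (T : X -> X) :
  bounded_operator M T <->
  exists2 C : R, 0 <= C & forall x, M x -> rnorm (T x) <= C * rnorm x.
Proof.
split=> [[C hC]|[C C0 hC]]; last first.
  by exists C => x Mx; rewrite !normE -rmorphM lecR; exact: hC.
exists `|C| => // x Mx; have := hC x Mx; rewrite !normE -rmorphM lecR => h.
by apply: le_trans h _; rewrite ler_wpM2r ?rnorm_ge0 ?ler_norm.
Qed.

Section BoundedMaps.
Variables (R : realType) (V W Z : normedZmodType R[i]).

Lemma bounded_map_comp (f : W -> Z) (g : V -> W) :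
  bounded_map f -> bounded_map g -> bounded_map (f \o g).
Proof.
move=> [C C0 hf] [D D0 hg]; exists (C * D); first exact: mulr_ge0.
by move=> x /=; apply: le_trans (hf _) _; rewrite -mulrA ler_wpM2l.
Qed.

Lemma bounded_mapB (f g : V -> W) :
  bounded_map f -> bounded_map g -> bounded_map (fun x => f x - g x).
Proof.
move=> [C C0 hf] [D D0 hg]; exists (C + D); first exact: addr_ge0.
move=> x; apply: le_trans (ler_rnormB _ _) _.
by rewrite mulrDl lerD.
Qed.

Lemma bounded_map_sum n (f : 'I_n -> V -> W) :
  (forall i, bounded_map (f i)) -> bounded_map (fun x => \sum_(i < n) f i x).
Proof.
elim: n f => [|n IH] f hf.
  by exists 0 => // x; rewrite big_ord0 rnorm0 mul0r.
have [C C0 hC] := hf ord0; have [i|D D0 hD] := IH (fun i => f (lift ord0 i)).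
  exact: hf.
exists (C + D) => [|x]; first exact: addr_ge0.
rewrite big_ord_recl mulrDl; apply: le_trans (ler_rnormD _ _) _.
exact: lerD.
Qed.

End BoundedMaps.

Lemma bounded_map_id (R : realType) (V : normedZmodType R[i]) :
  bounded_map (@id V).
Proof. by exists 1 => // x; rewrite mul1r. Qed.

Lemma bounded_map_iter (R : realType) (V : normedZmodType R[i]) (T : V -> V) n :
  bounded_map T -> bounded_map (iter n T).
Proof.
move=> bT; elim: n => [|n IH]; first exact: bounded_map_id.
exact: (bounded_map_comp bT IH).
Qed.

Lemma bounded_mapZ (R : realType) (V : normedZmodType R[i]) (W : normedModType R[i])
    (k : R[i]) (f : V -> W) :
  bounded_map f -> bounded_map (fun x => k *: f x).
Proof.
move=> [C C0 hf]; exists (rnorm k * C); first by rewrite mulr_ge0 ?rnorm_ge0.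
by move=> x; rewrite rnormZ -mulrA ler_wpM2l ?rnorm_ge0.
Qed.

Lemma bounded_map_rank1 (R : realType) (V : normedZmodType R[i])
    (W : normedModType R[i]) (phi : V -> R[i]) (w : W) :
  bounded_map phi -> bounded_map (fun x => phi x *: w).
Proof.
move=> [C C0 hf]; exists (C * rnorm w); first by rewrite mulr_ge0 ?rnorm_ge0.
by move=> x; rewrite rnormZ mulrAC ler_wpM2r ?rnorm_ge0.
Qed.

(** * Constructions of closed subspaces *)

Section ClosedSubspaces.
Variables (R : realType) (X : completeNormedModType R[i]).

Lemma closed_subspace0 : closed_subspace [set (0 : X)].
Proof.
apply/closed_lin_subspaceP; split=> //; last first.
  by move=> c x y -> ->; rewrite scaler0 addr0.
apply/closedP => x hx; apply: contrapT => /eqP /rnorm_gt0 x0.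
by have [_ ->] := hx _ x0; rewrite subr0 ltxx.
Qed.

Lemma closed_subspaceI (A B : set X) :
  closed_subspace A -> closed_subspace B -> closed_subspace (A `&` B).
Proof.
move=> /closed_lin_subspaceP[cA A0 lA] /closed_lin_subspaceP[cB B0 lB].
apply/closed_lin_subspaceP; split=> //; first exact: closedI.
by move=> c x y [Ax Bx] [Ay By]; split; [exact: lA|exact: lB].
Qed.

Lemma closed_subspace_preimage (A : set X) (f : {linear X -> X}) :
  bounded_map f -> closed_subspace A -> closed_subspace (f @^-1` A).
Proof.
move=> [C C0 hf] sA; have /closed_lin_subspaceP[_ A0 lA] := sA.
apply/closed_lin_subspaceP; split; rewrite /preimage /=; last first.
- by move=> c x y; rewrite linearP; exact: lA.
- by rewrite linear0.
apply/closedP => x hx; apply: subspace_lim sA _ => e e0.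
have C1 : 0 < C + 1 by lra.
have [|a Aa xa] := hx (e / (C + 1)); first by rewrite divr_gt0.
exists (f a) => //; rewrite -linearB; apply: le_lt_trans (hf _) _.
move: xa; rewrite ltr_pdivlMr // => xa.
by have := rnorm_ge0 (x - a); lra.
Qed.

End ClosedSubspaces.

(** * The resolvent on nilpotent vectors *)

Section Resolvent.
Variables (K : fieldType) (V : lmodType K) (T : {linear V -> V}) (l : K).
Hypothesis l0 : l != 0.

(* The truncated Neumann series [- \sum_(j < n) l ^- j.+1 *: iter j T x]. *)
Fixpoint neumann n (x : V) : V :=
  if n is m.+1 then l^-1 *: (neumann m (T x) - x) else 0.

Lemma neumann_comm n (Q : {linear V -> V}) :
  (forall x, Q (T x) = T (Q x)) -> forall x, Q (neumann n x) = neumann n (Q x).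
Proof.
move=> QT; elim: n => [|n IH] x /=; first by rewrite linear0.
by rewrite linearZ linearB IH QT.
Qed.

(** The Neumann series stops on a vector killed by [iter n T], so the truncated sum inverts [T - l]
    there exactly. The induction passes from [x] to [T x]. *)
Lemma neumannK n x : iter n T x = 0 -> T (neumann n x) - l *: neumann n x = x.
Proof.
elim: n x => [|n IH] x /=; first by move=> ->; rewrite linear0 scaler0 subrr.
rewrite -iterS iterSr => /IH h.
rewrite linearZ /= scalerA mulrC -scalerA -scalerBr.
rewrite [T (_ - _)]linearB [l *: (_ - _)]scalerBr.
by rewrite opprD addrACA -opprD h opprB addrC subrK scalerA mulVf // scale1r.
Qed.

Lemma neumannKl n x : iter n T x = 0 -> neumann n (T x - l *: x) = x.
Proof.
elim: n x => [|n IH] x /=; first by move=> ->.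
rewrite -iterS iterSr => /IH h.
rewrite [T (_ - _)]linearB [T (l *: _)]linearZ h opprB addrC subrK.
by rewrite scalerA mulVf // scale1r.
Qed.

End Resolvent.

Lemma neumann_bounded (R : realType) (X : normedModType R[i]) (T : {linear X -> X})
  (l : R[i]) n : bounded_map T -> bounded_map (neumann T l n).
Proof.
move=> bT; elim: n => [|n IH] /=; first by exists 0 => // x; rewrite rnorm0 mul0r.
apply: bounded_mapZ; apply: bounded_mapB (bounded_map_id _).
exact: (bounded_map_comp IH bT).
Qed.

(** * Moving the range of a projection from [M] to [N] *)

Section SplitOff.
Variables (R : realType) (X : completeNormedModType R[i]).
Variables (T Q : {linear X -> X}) (M N : set X) (n : nat).
Hypotheses (bT : bounded_map T) (bQ : bounded_map Q).
Hypothesis QT : forall x, Q (T x) = T (Q x).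
Hypothesis QQ : forall x, Q (Q x) = Q x.
Hypothesis QM : Defs.invariant Q M.
Hypothesis QN : forall x, N x -> Q x = 0.
Hypothesis nilQ : forall x, iter n T (Q x) = 0.

Let P : {linear X -> X} := idfun \- Q.
Let M1 := M `&` Q @^-1` [set 0].
(** This is the sum of [N] and the range of [Q], since the projection [Q] kills [N]. Written as a
    preimage under a bounded map, it is visibly closed. *)
Let N1 := P @^-1` N.

Lemma split_off_decomposition : decomposition T M N -> decomposition T M1 N1.
Proof.
move=> [sM sN TM TN [MN MN0]]; split.
- apply: closed_subspaceI => //.
  exact: closed_subspace_preimage bQ (closed_subspace0 X).
- apply: closed_subspace_preimage sN; exact: bounded_mapB (bounded_map_id _) bQ.
- by move=> x [Mx Qx]; split; [exact: TM|rewrite /preimage /= QT Qx linear0].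
- by move=> x; rewrite /N1 /preimage /= QT -linearB; exact: TN.
split=> [x|].
  have [y [z [My Nz ->]]] := MN x; exists (y - Q y), (Q y + z); split.
  - split; first by apply: subspaceB => //; exact: QM.
    by rewrite /preimage /= linearB QQ subrr.
  - by rewrite /N1 /preimage /= linearD QQ (QN Nz) addr0 addrAC subrr add0r.
  - by rewrite addrA subrK.
apply/seteqP; split=> x /=.
  move=> [[Mx Qx]]; rewrite /N1 /preimage /= Qx subr0 => Nx.
  by rewrite -[_ = 0]/([set 0] x) -MN0.
move=> ->; split; first by split; [exact: subspace0|rewrite /preimage /= linear0].
by rewrite /N1 /preimage /= linear0 subrr; exact: subspace0.
Qed.

(** For [l != 0] the inverse of [T - l] is glued from its inverse [S] on [N] and the truncated
    Neumann series on the range of [Q], where [T] is nilpotent. *)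
Lemma split_off_quasi_nilpotent :
  closed_subspace N -> quasi_nilpotent N T -> quasi_nilpotent N1 T.
Proof.
move=> sN qN l notinv; apply: contrapT => /= /eqP l0; apply: notinv.
have [S [SN /bounded_operatorP[C C0 hS] SK]] : invertible N (fun x => T x - l *: x).
  by apply: contrapT => ni; move/eqP: l0; apply; exact: qN.
have NP x : N1 x -> N (x - Q x) by [].
have Pn x : N x -> x - Q x = x by move=> Nx; rewrite QN // subr0.
pose G := neumann T l n.
have QG x : Q (G (Q x)) = G (Q x) by rewrite neumann_comm // QQ.
exists (fun x => S (x - Q x) + G (Q x)); split.
- move=> x /NP Nx; rewrite /N1 /preimage /= linearD QG (QN (SN _ Nx)) add0r addrK.
  exact: SN.
- apply/bounded_operatorP.
  have [D D0 hG] := bounded_map_comp (neumann_bounded l n bT) bQ.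
  have [E E0 hP] : bounded_map P by exact: bounded_mapB (bounded_map_id _) bQ.
  exists (C * E + D) => [|x /NP Nx]; first by rewrite addr_ge0 ?mulr_ge0.
  apply: le_trans (ler_rnormD _ _) _; rewrite mulrDl; apply: lerD; last exact: hG.
  apply: le_trans (hS _ Nx) _; rewrite -mulrA ler_wpM2l //; exact: hP.
- move=> x /NP Nx; have [Sl Sr] := SK _ Nx; split.
    have -> : Q (T x - l *: x) = T (Q x) - l *: Q x.
      by rewrite linearB QT [Q (l *: x)]linearZ.
    rewrite /G neumannKl //.
    rewrite (_ : _ - _ - _ = T (x - Q x) - l *: (x - Q x)) ?Sl ?subrK //.
    by rewrite [T (_ - _)]linearB [l *: (_ - _)]scalerBr !opprD [LHS]addrACA.
  by rewrite linearD scalerDr opprD addrACA Sr neumannK // subrK.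
Qed.

End SplitOff.

(** * Jordan chains and their projections *)

Section JordanChain.
Variables (K : fieldType) (V : lmodType K) (T : {linear V -> V}) (phi : {scalar V}).
Variable m : nat.

Lemma iter_eq0 v j : iter m.+1 T v = 0 -> (m < j)%N -> iter j T v = 0.
Proof. by move=> v0 /subnK <-; rewrite iterD v0 linear0. Qed.

(** Adding a multiple of [iter k.+1 T w] to [w] can cancel [phi] at exponent [m - k.+1] and changes
    nothing at higher exponents, because [iter m.+1 T w = 0]. The exponents are cleared downwards
    from [m - 1]. *)
Lemma chain_correction (M : V -> Prop) v :
  (forall (c : K) x y, M x -> M y -> M (c *: x + y)) -> (forall x, M x -> M (T x)) ->
  M v -> iter m.+1 T v = 0 -> phi (iter m T v) = 1 ->
  exists w, [/\ M w, iter m.+1 T w = 0 & forall j, phi (iter j T w) = (j == m)%:R].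
Proof.
move=> lM TM Mv v0 v1.
suff H k : exists w, [/\ M w, iter m.+1 T w = 0, phi (iter m T w) = 1 &
    forall j, (m - k <= j < m)%N -> phi (iter j T w) = 0].
  have [w [Mw w0 w1 wj]] := H m; exists w; split=> // j.
  have [->//|jm] := eqVneq j m; have [ltjm|] := ltnP j m.
    by rewrite wj // subnn.
  by rewrite leq_eqVlt eq_sym (negbTE jm) => /iter_eq0 ->; rewrite ?linear0.
elim: k => [|k [w [Mw w0 w1 wj]]].
  by exists v; split=> // j; rewrite subn0 ltnNge andbN.
have [mk|km] := leqP m k.
  by exists w; split=> // j jm; apply: wj; lia.
pose a := phi (iter (m - k.+1) T w).
have iterM j x : M x -> M (iter j T x) by elim: j => //= j IH /IH; exact: TM.
have wE j : iter j T (- a *: iter k.+1 T w + w) =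
    - a *: iter (j + k.+1) T w + iter j T w.
  by rewrite linearP iterD.
exists (- a *: iter k.+1 T w + w); split.
- by apply: lM => //; exact: iterM.
- by rewrite wE w0 addr0 iter_eq0 ?scaler0 //; lia.
- by rewrite wE iter_eq0 ?scaler0 ?add0r //; lia.
- move=> j jm; rewrite wE linearP.
  have [jE|jn] := eqVneq j (m - k.+1)%N.
    by rewrite jE subnK // w1 mulr1 -/a addNr.
  by rewrite iter_eq0 ?linear0 ?mulr0 ?add0r ?wj //; lia.
Qed.

Variable w : V.
Hypotheses (w0 : iter m.+1 T w = 0) (wphi : forall j, phi (iter j T w) = (j == m)%:R).
Hypothesis phi0 : forall x, phi (iter m.+1 T x) = 0.

(* The projection onto [span (w, T w, ..., T^m w)] along the common kernel of
   the functionals [phi \o iter j T]: those for [j <= m] form the dual basis. *)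
Definition chain_proj (x : V) : V :=
  \sum_(i < m.+1) phi (iter (m - i) T x) *: iter i T w.

Lemma chain_proj_linear : linear chain_proj.
Proof.
move=> c x y; rewrite /chain_proj scaler_sumr -big_split; apply: eq_bigr => i _ /=.
by rewrite !linearP scalerDl scalerA.
Qed.

(** Both sides are the same sum shifted by one index; of the two end terms, one vanishes by [phi0]
    and the other by [w0]. *)
Lemma chain_projT x : chain_proj (T x) = T (chain_proj x).
Proof.
rewrite /chain_proj big_ord_recl big_ord_recr /= linearD.
rewrite subn0 -iterSr phi0 scale0r add0r.
rewrite [T (phi _ *: _)]linearZZ -iterS w0 scaler0 addr0.
rewrite linear_sum; apply: eq_bigr => i _.
by rewrite linearZ /= /bump /= add1n -iterSr subnSK.
Qed.

Lemma phi_chain_proj x : phi (chain_proj x) = phi x.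
Proof.
rewrite /chain_proj linear_sum big_ord_recr /= big1 ?add0r.
  by rewrite linearZ /= subnn wphi eqxx mulr1.
by move=> i _; rewrite linearZ /= wphi ltn_eqF ?mulr0.
Qed.

Lemma iter_chain_proj j x : iter j T (chain_proj x) = chain_proj (iter j T x).
Proof. by elim: j => //= j ->; rewrite chain_projT. Qed.

(** The coefficients are values of [phi] on iterates of [x]; they are unchanged because the
    projection commutes with [T] and preserves [phi]. *)
Lemma chain_projK x : chain_proj (chain_proj x) = chain_proj x.
Proof.
rewrite [LHS]/chain_proj; apply: eq_bigr => i _.
by rewrite iter_chain_proj phi_chain_proj.
Qed.

Lemma chain_proj_nil x : iter m.+1 T (chain_proj x) = 0.
Proof.
rewrite iter_chain_proj /chain_proj big1 // => i _.
by rewrite -iterD addnC iterD phi0 scale0r.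
Qed.

End JordanChain.

(** * Ranges of powers of a Fredholm summand *)

Section Main.
Variables (R : realType) (X : completeNormedModType R[i]) (T : {linear X -> X}).
Hypothesis bT : bounded_map T.

Lemma iter_invariant (M : set X) n : Defs.invariant T M -> Defs.invariant (iter n T) M.
Proof. by move=> TM; elim: n => //= n IH x /IH; exact: TM. Qed.

(** If [e] spans [M] modulo [T M] and [f] spans it modulo [T^n M], then [e] together with [T f]
    spans it modulo [T^(n+1) M]. *)
Lemma finite_codim_iter (M : set X) n : Defs.invariant T M ->
  finite_codim M (T @` M) -> finite_codim M (iter n T @` M).
Proof.
move=> TM [m [e [Me He]]]; elim: n => [|n [k [f [Mf Hf]]]].
  have z : 'I_0 -> X by case.
  exists 0%N, z; split=> [[]//|x Mx].
  by exists (fun=> 0); rewrite big_ord0 subr0; exists x.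
exists (m + k)%N.
exists (fun i => match fintype.split i with inl a => e a | inr b => T (f b) end).
split=> [i|x Mx]; first by case: (fintype.split i) => a; [exact: Me|exact/TM/Mf].
have [c [y My yE]] := He x Mx; have [d [z Mz zE]] := Hf y My.
exists (fun i => match fintype.split i with inl a => c a | inr b => d b end).
exists z => //; rewrite iterS zE linearB yE big_split_ord /= opprD addrA.
congr (_ - _ - _).
  by apply: eq_bigr => i _; rewrite -[lshift _ _]/(unsplit (inl i)) unsplitK.
rewrite linear_sum; apply: eq_bigr => i _.
by rewrite -[rshift _ _]/(unsplit (inr i)) unsplitK linearZ.
Qed.

Variables (M N : set X).
Hypothesis dec : decomposition T M N.

(** As [M] meets [N] only in [0], [u] is outside [T^n M + N]; generators of [M] modulo [T^n M] span
    [X] modulo that sum. *)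
Lemma range_separation n u : finite_codim M (T @` M) -> M u -> ~ (iter n T @` M) u ->
  exists phi : {scalar X}, [/\ bounded_map phi,
    forall x, M x -> phi (iter n T x) = 0, forall x, N x -> phi x = 0 & phi u = 1].
Proof.
have [sM sN TM TN [MN MN0]] := dec => codim Mu nu.
have [m [e [Me He]]] := finite_codim_iter n TM codim.
have [||phi [bphi phi0 phiu]] := @range_add_separation R X M (iter n T) sM
    (bounded_map_iter n bT) m e N u sN.
- move=> [a [b [Ma Nb uE]]]; apply: nu; exists a => //.
  suff b0 : b = 0 by rewrite uE b0 addr0.
  rewrite -[b = 0]/([set 0] b) -MN0; split=> //.
  rewrite (_ : b = u - iter n T a); last by rewrite uE addrAC subrr add0r.
  by apply: subspaceB => //; exact: iter_invariant.
- move=> x; have [y [z [My Nz ->]]] := MN x; have [c [a Ma aE]] := He y My.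
  exists 0, c, a, z; split=> //.
  by rewrite -[X in _ = X + _]/(iter n T a) aE scale0r subr0 addrAC.
exists phi; split=> // x Ax; apply: phi0.
  by exists x, 0; rewrite addr0; split=> //; exact: subspace0.
by exists 0, x; rewrite linear0 add0r; split=> //; exact: subspace0.
Qed.

Lemma closed_range : finite_codim M (T @` M) -> closed (T @` M).
Proof.
have [sM _ TM _ _] := dec => codim.
apply/closedP => x hx; apply: contrapT => nx.
have Mx : M x.
  by apply: subspace_lim sM _ => e /hx[_ [a Ma <-] xa]; exists (T a) => //; exact: TM.
have [phi [[C C0 hphi] phi0 _ phix]] := range_separation (n := 1) codim Mx nx.
have C1 : 0 < C + 1 by lra.
(* At this distance [1 = rnorm (phi (x - T a)) <= C / (C + 1)], which is absurd. *)
have [|_ [a Ma <-] xa] := hx (C + 1)^-1; first by rewrite invr_gt0.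
have := hphi (x - T a); rewrite linearB phix (phi0 _ Ma) subr0 rnorm1.
move: xa; rewrite -[_^-1]mul1r ltr_pdivlMr //.
by have := rnorm_ge0 (x - T a); lra.
Qed.

(** If no exponent were the last one for a kernel vector, induction would place that vector in the
    range of every power. *)
Lemma kernel_escape : ~ (Defs.kernel M T `<=` hyper_range M T) ->
  exists m u v, [/\ M v, iter m T v = u, T u = 0 & ~ (iter m.+1 T @` M) u].
Proof.
move=> H; apply: contrapT => G; apply: H => u [Mu Tu] n _.
elim: n => [|n [v Mv vu]]; first by exists u.
by apply: contrapT => nu; apply: G; exists n, u, v.
Qed.

End Main.

(* If one generator is not killed by [phi], it can be used to correct the
   others and then be dropped. *)
Lemma finite_dim_restrict (R : realType) (X : normedModType R[i]) (A : set X) k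
    (e : 'I_k.+1 -> X) (phi : {scalar X}) u :
  (forall (c : R[i]) x y, A x -> A y -> A (c *: x + y)) ->
  (forall i, A (e i)) ->
  (forall x, A x -> exists c : 'I_k.+1 -> R[i], x = \sum_(i < k.+1) c i *: e i) ->
  A u -> phi u = 1 ->
  exists f : 'I_k -> X, (forall i, A (f i) /\ phi (f i) = 0) /\
    forall x, A x -> phi x = 0 -> exists c : 'I_k -> R[i], x = \sum_(i < k) c i *: f i.
Proof.
move=> lA Ae span Au phiu.
have [i0 phi0] : exists i, phi (e i) != 0.
  apply: contrapT => H; have [c uE] := span u Au.
  have : phi u = 0.
    rewrite uE linear_sum big1 // => i _; rewrite linearZ /=.
    have [->|ne] := eqVneq (phi (e i)) 0; first by rewrite mulr0.
    by case: H; exists i.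
  by rewrite phiu; apply/eqP; exact: oner_neq0.
pose f i := - (phi (e (lift i0 i)) / phi (e i0)) *: e i0 + e (lift i0 i).
exists f; split=> [i|x Ax phix].
  split; first exact: lA.
  by rewrite linearP /= mulNr divfK // addNr.
have [c xE] := span x Ax; exists (c \o lift i0) => /=.
move: phix; rewrite {}xE (bigD1_ord i0) //= linearD linear_sum linearZ /=.
move=> phix; rewrite /f.
under [RHS]eq_bigr do rewrite scalerDr scalerA.
(* The other coefficients agree by construction; [phi x = 0] determines that of [e i0]. *)
rewrite big_split /= -scaler_suml; congr (_ *: _ + _).
under eq_bigr do rewrite mulrN mulrA.
rewrite sumrN -mulr_suml -mulNr; apply: (canRL (mulfK phi0)).
move/eqP: phix; rewrite addr_eq0 => /eqP ->.
by congr (- _); apply: eq_bigr => i _; rewrite linearZ.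
Qed.

(** * Induction on the number of generators of the kernel *)

Theorem theorem2p1 (R : realType) (X : completeNormedModType R[i])
    (T : {linear X -> X}) (hT : bounded_operator setT T) :
  pseudo_B_fredholm T -> pseudo_fredholm T.
Proof.
have bT : bounded_map T.
  by have /bounded_operatorP[C C0 hC] := hT; exists C => // x; exact: hC.
move=> [M [N [dec [[k [e [ke espan]]] codim] qN]]].
elim: k M N e dec ke espan codim qN => [|k IH] M N e dec ke espan codim qN.
  exists M, N; split=> //; split; first exact: closed_range dec codim.
  move=> x kx; have [c] := espan x kx; rewrite big_ord0 subr0 => ->.
  have [sM _ _ _ _] := dec.
  by move=> n _; exists 0; [exact: subspace0|rewrite linear0].
have [kato_ker|/kernel_escape[m [u [v [Mv vu Tu nu]]]]] :=
    pselect (Defs.kernel M T `<=` hyper_range M T).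
  by exists M, N; split=> //; split=> //; exact: closed_range dec codim.
have [sM sN TM TN [MN MN0]] := dec.
have Mu : M u by rewrite -vu; exact: iter_invariant.
have [phi [bphi phiM phiN phiu]] := range_separation bT dec codim Mu nu.
have [w [Mw w0 wphi]] : exists w, [/\ M w, iter m.+1 T w = 0 &
    forall j, phi (iter j T w) = (j == m)%:R].
  have /closed_lin_subspaceP[_ _ lM] := sM.
  (* The chain starts from [v]: [T^(m+1) v = T u = 0] and [phi (T^m v) = phi u = 1]. *)
  by apply: (chain_correction lM TM Mv); rewrite ?iterS vu.
have phi0 x : phi (iter m.+1 T x) = 0.
  have [y [z [My Nz ->]]] := MN x.
  have Nz' : N (iter m.+1 T z) by exact: (iter_invariant _ TN).
  by rewrite (linearD (iter m.+1 T)) linearD (phiM _ My) (phiN _ Nz') addr0.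
pose Q : {linear X -> X} := HB.pack (chain_proj T phi m w)
  (GRing.isLinear.Build R[i] X X *:%R _ (chain_proj_linear T phi m w)).
have QT x : Q (T x) = T (Q x) by exact: chain_projT.
have QQ x : Q (Q x) = Q x by exact: chain_projK.
have bQ : bounded_map Q.
  apply: bounded_map_sum => i; apply: bounded_map_rank1.
  exact: bounded_map_comp bphi (bounded_map_iter _ bT).
have QM : Defs.invariant Q M.
  move=> x Mx; apply: subspace_sum => // i; apply: subspaceZ => //.
  exact: (iter_invariant _ TM).
have QN x : N x -> Q x = 0.
  move=> Nx; rewrite /= /chain_proj big1 // => i _.
  by rewrite phiN ?scale0r //; exact: (iter_invariant _ TN).
have nilQ x : iter m.+1 T (Q x) = 0 by exact: chain_proj_nil.
(* With [phiQ]: on the kernel of [T], [Q] and [phi] vanish at the same vectors. The new kernel is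
   thus the old one cut by [phi], and [finite_dim_restrict] spares a generator. *)
have Qker x : T x = 0 -> phi x = 0 -> Q x = 0.
  move=> Tx phix; rewrite /= /chain_proj big1 // => i _.
  case: (m - i)%N => [|j]; first by rewrite phix scale0r.
  by rewrite iterSr Tx !linear0 scale0r.
have phiQ x : Q x = 0 -> phi x = 0.
  move=> Qx; rewrite -(phi_chain_proj wphi).
  by rewrite -[chain_proj _ _ _ _ _]/(Q x) Qx linear0.
have [|x kx||f [kf fspan]] :=
    @finite_dim_restrict R X (Defs.kernel M T) k e phi u _ ke _ _ phiu.
- move=> c x y [Mx Tx] [My Ty]; split; last by rewrite linearP Tx Ty scaler0 addr0.
  by apply: subspaceD => //; exact: subspaceZ.
- by have [c /subr0_eq] := espan x kx; exists c.
- by [].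
clearbody Q; apply: (IH _ _ f (split_off_decomposition bQ QT QQ QM QN dec) _ _ _
  (split_off_quasi_nilpotent bT bQ QT QQ QN nilQ sN qN)).
- by move=> i; have [[Mf Tf] phif] := kf i; do ?split=> //; exact: Qker.
- move=> x [[Mx Qx] Tx]; have [||c ->] := fspan x _ _; [by []|exact: phiQ|].
  by exists c; rewrite subrr.
(* Applying [I - Q], which fixes [x] and commutes with [T], carries the finite codimension over to
   the smaller summand. *)
- have [n [g [Mg gspan]]] := codim.
  exists n, (fun i => g i - Q (g i)); split=> [i|x [Mx Qx]].
    split; first by apply: subspaceB => //; exact: QM.
    by rewrite /preimage /= linearB QQ subrr.
  have [c [y My yE]] := gspan x Mx; exists c, (y - Q y).
    split; first by apply: subspaceB => //; exact: QM.
    by rewrite /preimage /= linearB QQ subrr.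
  have -> : \sum_(i < n) c i *: (g i - Q (g i)) =
      \sum_(i < n) c i *: g i - Q (\sum_(i < n) c i *: g i).
    by rewrite linear_sum -sumrB; apply: eq_bigr => i _; rewrite linearZ scalerBr.
  by rewrite linearB -QT yE linearB Qx sub0r opprK opprB addrA addrAC.
Qed.
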